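(* The following classes of graphs are not intersectionwise self-$\chi$-guarding: (i) the class of chair-free graphs; (ii) the class of $(K_{1,3}+K_1)$-free graphs.
   Context: All graphs are finite and simple. A chair is the graph on five vertices obtained by identifying one vertex of a $P_2$ with a vertex of degree two of a $P_4$. $G+H$ denotes disjoint union; $K_{1,3}$ is the claw. A graph is $H$-free if it has no induced subgraph isomorphic to $H$. The $k$-fold graph-intersection of a class $\mathcal{A}$ is the class of all graphs $(\bigcap_{i\in[k]}V(G_i),\bigcap_{i\in[k]}E(G_i))$ with $G_1,\dots,G_k\in\mathcal{A}$. A class is $\chi$-bounded if there is a non-decreasing $f:\mathbb{N}\to\mathbb{N}$ with $\chi(G)\le f(\omega(G))$ for all members. A class $\mathcal{A}$ is intersectionwise self-$\chi$-guarding if for every positive integer $k$ the $k$-fold graph-intersection of $\mathcal{A}$ is $\chi$-bounded. *)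

(* Defs.v *)
From HB Require Import structures.
From mathcomp Require Import all_boot finmap.

Set Implicit Arguments.
Unset Strict Implicit.
Unset Printing Implicit Defensive.

Local Open Scope fset_scope.

(* The vertices of a graph are drawn from an ambient type U, which may be
   infinite; this lets graphs with different vertex sets be intersected. *)
Record graph (U : choiceType) := Graph {
  vertices : {fset U};
  edges : {fset {fset U}};
  edges_wf : all (fun e : {fset U} => (e `<=` vertices) && (#|` e| == 2)) edges
}.

(* adj G x x is always false, since an edge has two elements. *)
Definition adj (U : choiceType) (G : graph U) : rel U :=
  fun x y => [fset x; y] \in edges G.

Definition isomorphic (U W : choiceType) (G : graph U) (H : graph W) : Prop :=
  exists2 f : vertices G -> vertices H, bijective f
    & forall x y : vertices G,
        adj H (val (f x)) (val (f y)) = adj G (val x) (val y).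

Fact induced_wf (U : choiceType) (G : graph U) (X : {fset U}) :
  all (fun e : {fset U} => (e `<=` X `&` vertices G) && (#|` e| == 2))
    [fset e in edges G | e `<=` X].
Proof.
apply/allP => e; rewrite !inE /= => /andP[eG eX].
by have /allP/(_ e eG) := edges_wf G; rewrite fsubsetI eX.
Qed.

Definition induced (U : choiceType) (G : graph U) (X : {fset U}) : graph U :=
  Graph (induced_wf G X).

(* A class of graphs, given on each ambient type. *)
Definition graph_class := forall U : choiceType, graph U -> Prop.

Definition free (W : choiceType) (H : graph W) : graph_class :=
  fun U G => ~ exists2 X : {fset U}, X `<=` vertices G
                 & isomorphic (induced G X) H.

Definition is_clique (U : choiceType) (G : graph U) (K : {fset U}) : bool :=
  [forall x : K, forall y : K, (x != y) ==> adj G (val x) (val y)].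

Definition omega (U : choiceType) (G : graph U) : nat :=
  \max_(K <- fpowerset (vertices G) | is_clique G K) #|` K|.

Definition colorable (U : choiceType) (G : graph U) (n : nat) : bool :=
  [exists c : {ffun vertices G -> 'I_n},
     [forall x, forall y, adj G (val x) (val y) ==> (c x != c y)]].

Fact ex_colorable (U : choiceType) (G : graph U) : exists n, colorable G n.
Proof.
exists #|{: vertices G}|; apply/existsP; exists [ffun x => enum_rank x].
apply/forallP => x; apply/forallP => y; apply/implyP => xy.
rewrite !ffunE; apply/eqP => /enum_rank_inj eq_xy; move: xy.
rewrite eq_xy /adj => eG; have /allP/(_ _ eG) := edges_wf G.
by rewrite cardfs2 eqxx andbF.
Qed.

Definition chi (U : choiceType) (G : graph U) : nat := ex_minn (ex_colorable G).

Definition chi_bounded (A : graph_class) : Prop :=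
  exists2 f : nat -> nat, {homo f : m n / m <= n}
    & forall (U : choiceType) (G : graph U), A U G -> chi G <= f (omega G).

Definition kfold_intersection (k : nat) (A : graph_class) : graph_class :=
  fun U H => exists G : 'I_k -> graph U,
    [/\ forall i, A U (G i),
        forall x : U, (x \in vertices H) = [forall i, x \in vertices (G i)]
      & forall e : {fset U}, (e \in edges H) = [forall i, e \in edges (G i)]].

Definition self_chi_guarding (A : graph_class) : Prop :=
  forall k : nat, 0 < k -> chi_bounded (kfold_intersection k A).

Fact disjoint_union_wf (U W : choiceType) (G : graph U) (H : graph W) :
  all (fun e : {fset U + W} =>
         (e `<=` [fset inl x | x in vertices G] `|` [fset inr y | y in vertices H])
         && (#|` e| == 2))
    ([fset [fset inl x | x in e] | e : {fset U} in edges G] `|`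
     [fset [fset inr y | y in e] | e : {fset W} in edges H]).
Proof.
apply/allP => e; rewrite in_fsetU => /orP[] /imfsetP[/= d dE ->].
- have /allP/(_ d dE)/andP[/fsubsetP sub d2] := edges_wf G.
  rewrite card_imfset ?d2 ?andbT /=; last by move=> ? ? [].
  apply/fsubsetP => _ /imfsetP[x /= xd ->].
  by rewrite in_fsetU in_imfset ?sub.
- have /allP/(_ d dE)/andP[/fsubsetP sub d2] := edges_wf H.
  rewrite card_imfset ?d2 ?andbT /=; last by move=> ? ? [].
  apply/fsubsetP => _ /imfsetP[x /= xd ->].
  by rewrite in_fsetU orbC in_imfset ?sub.
Qed.

Definition disjoint_union (U W : choiceType) (G : graph U) (H : graph W) :
  graph (U + W)%type := Graph (disjoint_union_wf G H).

(* The path 0 - 1 - 2 - 3, with an extra vertex 4 attached to 1. *)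
Fact chair_wf :
  all (fun e : {fset nat} => (e `<=` [fset 0; 1; 2; 3; 4]) && (#|` e| == 2))
    [fset [fset 0; 1]; [fset 1; 2]; [fset 2; 3]; [fset 1; 4]].
Proof.
apply/allP => e; rewrite !inE -!orbA => /or4P[] /eqP ->; rewrite cardfs2 andbT;
by apply/fsubsetP => x; rewrite !inE => /orP[] /eqP ->.
Qed.

Definition chair : graph nat := Graph chair_wf.

Fact claw_wf :
  all (fun e : {fset nat} => (e `<=` [fset 0; 1; 2; 3]) && (#|` e| == 2))
    [fset [fset 0; 1]; [fset 0; 2]; [fset 0; 3]].
Proof.
apply/allP => e; rewrite !inE -!orbA => /or3P[] /eqP ->; rewrite cardfs2 andbT;
by apply/fsubsetP => x; rewrite !inE => /orP[] /eqP ->.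
Qed.

Definition claw : graph nat := Graph claw_wf.

Fact K1_wf :
  all (fun e : {fset nat} => (e `<=` [fset 0]) && (#|` e| == 2)) fset0.
Proof. by apply/allP => e; rewrite inE. Qed.

Definition K1 : graph nat := Graph K1_wf.

(* Main.v *)
(** Fix [n] and let the vertices be the arcs [(i, j)], [i < j < n].  The shift
    graph joins [(i, j)] to [(j, k)]; it is triangle-free and its chromatic
    number is at least [log2 n].  Two arcs are adjacent in it iff they share an
    endpoint, have distinct tails and have distinct heads, so it is the
    intersection of a line graph and of two complete multipartite graphs.  Line
    graphs have no induced claw and complete multipartite graphs have no induced
    [K2 + K1], whereas the chair and [K_{1,3} + K_1] contain both. *)

Require Import Defs.
From mathcomp Require Import all_boot finmap.
From mathcomp Require Import zify.

Set Implicit Arguments.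
Unset Strict Implicit.
Unset Printing Implicit Defensive.

Local Open Scope fset_scope.

(** * Forbidden patterns and induced copies *)

Lemma adj_vertices (U : choiceType) (G : graph U) (x y : U) :
  adj G x y -> (x \in vertices G) && (y \in vertices G).
Proof.
move=> xy; have /allP/(_ _ xy)/andP[/fsubsetP sub _] := edges_wf G.
by rewrite !sub // !inE eqxx ?orbT.
Qed.

(** The centre differs from the leaves because [adj] is irreflexive, and all four points are
    vertices because each lies on an edge. *)
Definition has_claw (U : choiceType) (G : graph U) : Prop :=
  exists c x y z, [/\ [&& x != y, x != z & y != z],
    [&& adj G c x, adj G c y & adj G c z]
    & [&& ~~ adj G x y, ~~ adj G x z & ~~ adj G y z]].

(** Only [z] lies on no edge of the pattern, so its membership must be required separately. *)
Definition has_K2_K1 (U : choiceType) (G : graph U) : Prop :=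
  exists x y z, [/\ z \in vertices G, (x != z) && (y != z),
    adj G x y & ~~ adj G x z && ~~ adj G y z].

(** Replacing the vertex set [X] by an injection that preserves and reflects adjacency lets any
    pattern found in [H] be carried over to [G]. *)
Lemma not_free_embedding (U W : choiceType) (G : graph U) (H : graph W) :
    (exists2 X : {fset U}, X `<=` vertices G & isomorphic (induced G X) H) ->
  exists g : vertices H -> U, [/\ injective g,
    forall x, g x \in vertices G
    & forall x y, adj G (g x) (g y) = adj H (val x) (val y)].
Proof.
case=> X _ [f [g fK gK] fadj]; exists (fun x => val (g x)).
have gP x : (val (g x) \in X) && (val (g x) \in vertices G).
  by rewrite -in_fsetI; apply: valP.
split=> [x y /val_inj/(can_inj gK)//|x|x y]; first by case/andP: (gP x).
rewrite -{2}[x]gK -{2}[y]gK fadj /adj /= !inE /=.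
suff -> : [fset val (g x); val (g y)] `<=` X by rewrite andbT.
have [/andP[gx _] /andP[gy _]] := (gP x, gP y).
by apply/fsubsetP => u; rewrite !inE => /orP[] /eqP->.
Qed.

Lemma free_of_no_claw (U W : choiceType) (G : graph U) (H : graph W) :
  has_claw H -> ~ has_claw G -> free H G.
Proof.
move=> [c [x [y [z [uH aH nH]]]]] nG /not_free_embedding[g [g_inj _ gadj]].
case: nG; have /and3P[/adj_vertices/andP[cH xH] /adj_vertices/andP[_ yH]] := aH.
case/adj_vertices/andP=> _ zH.
exists (g [` cH]), (g [` xH]), (g [` yH]), (g [` zH]).
by rewrite !gadj !(inj_eq g_inj) -!val_eqE.
Qed.

Lemma free_of_no_K2_K1 (U W : choiceType) (G : graph U) (H : graph W) :
  has_K2_K1 H -> ~ has_K2_K1 G -> free H G.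
Proof.
move=> [x [y [z [zH uH aH nH]]]] nG /not_free_embedding[g [g_inj gG gadj]].
case: nG; have /andP[xH yH] := adj_vertices aH.
exists (g [` xH]), (g [` yH]), (g [` zH]).
by rewrite !gadj !(inj_eq g_inj) -!val_eqE gG.
Qed.

Lemma fset2_eq (U : choiceType) (x y a b : U) :
  ([fset x; y] == [fset a; b]) =
  ((x == a) && (y == b)) || ((x == b) && (y == a)).
Proof.
apply/eqP/idP => [E|/orP[]/andP[/eqP-> /eqP->]//]; last by rewrite fsetUC.
move/fsetP: E => E; have := (E x, E y, E a, E b).
rewrite !inE !eqxx ?orbT /= ![a == _]eq_sym ![b == _]eq_sym.
by do 4!case: eqP => //=; move=> ? ? ? ? [[[]]].
Qed.

Lemma chair_has_claw : has_claw chair.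
Proof. by exists 1, 0, 2, 4; rewrite /adj /= !inE /= !fset2_eq. Qed.

Lemma chair_has_K2_K1 : has_K2_K1 chair.
Proof. by exists 2, 3, 4; rewrite /adj /= !inE /= !fset2_eq. Qed.

(** * Patterns in disjoint unions *)

Section DisjointUnion.
Variables (U W : choiceType) (G : graph U) (H : graph W).

Lemma adj_inl (x y : U) :
  adj (disjoint_union G H) (inl x) (inl y) = adj G x y.
Proof.
have inl_inj : injective (@inl U W) by move=> ? ? [].
rewrite /adj /= in_fsetU -imfset_fset2; apply/orP/idP => [[]|xy]; last first.
- by left; apply/imfsetP; exists [fset x; y].
(* An edge coming from [H] contains only points [inr y], so it cannot contain [inl x]. *)
- case/imfsetP=> /= e _ /fsetP/(_ (inl x)).
  by rewrite mem_imfset //= !inE eqxx /= => /esym/imfsetP[].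
case/imfsetP=> /= e eG /fsetP E; suff -> : [fset x; y] = e by [].
by apply/fsetP => u; have := E (inl u); rewrite !mem_imfset.
Qed.

Lemma adj_inl_inr (x : U) (y : W) :
  adj (disjoint_union G H) (inl x) (inr y) = false.
Proof.
apply/negP; rewrite /adj /= in_fsetU.
case/orP=> /imfsetP[/= e _ /fsetP E].
  by have := E (inr y); rewrite !inE eqxx orbT => /esym/imfsetP[].
by have := E (inl x); rewrite !inE eqxx => /esym/imfsetP[].
Qed.

Lemma has_claw_disjoint_union : has_claw G -> has_claw (disjoint_union G H).
Proof.
move=> [c [x [y [z clawG]]]]; exists (inl c), (inl x), (inl y), (inl z).
by rewrite !adj_inl.
Qed.

Lemma has_K2_K1_disjoint_union (x y : U) (z : W) :
  adj G x y -> z \in vertices H -> has_K2_K1 (disjoint_union G H).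
Proof.
move=> xy zH; exists (inl x), (inl y), (inr z).
rewrite adj_inl !adj_inl_inr; split=> //=.
by rewrite in_fsetU (in_imfset _ inr) ?zH ?orbT //= => ? ? [].
Qed.

End DisjointUnion.

Lemma claw_has_claw : has_claw claw.
Proof. by exists 0, 1, 2, 3; rewrite /adj /= !inE /= !fset2_eq. Qed.

(** * Graphs given by a relation, and their intersections *)

Section GraphOf.
Variables (U : choiceType) (V : {fset U}).
Implicit Type r : rel U.

Fact graph_of_wf r :
  all (fun e : {fset U} => (e `<=` V) && (#|` e| == 2))
    [fset [fset p.1; p.2] |
       p in [fset p in V `*` V | (p.1 != p.2) && r p.1 p.2]].
Proof.
apply/allP => e /imfsetP[[x y] /=]; rewrite !inE /= => /andP[/andP[xV yV]].
case/andP=> xy _ ->; rewrite cardfs2 xy andbT.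
by apply/fsubsetP => z; rewrite !inE => /orP[] /eqP->.
Qed.

Definition graph_of r : graph U := Graph (graph_of_wf r).

Lemma edges_graph_of r e : reflect
  (exists x y, [/\ x \in V, y \in V, x != y, r x y & e = [fset x; y]])
  (e \in edges (graph_of r)).
Proof.
apply: (iffP (imfsetP _ _ _ _)) => /= [[[x y]]|[x [y [xV yV xy rxy ->]]]].
  rewrite !inE /= => /andP[/andP[xV yV] /andP[xy rxy]] ->.
  by exists x, y.
by exists (x, y); rewrite // !inE /= xV yV xy.
Qed.

Lemma adj_graph_of r x y : symmetric r ->
  adj (graph_of r) x y = [&& x \in V, y \in V, x != y & r x y].
Proof.
move=> r_sym; apply/edges_graph_of/and4P => [[a [b [aV bV ab rab /eqP]]]|[]].
  rewrite fset2_eq => /orP[] /andP[/eqP-> /eqP->] //.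
  by rewrite eq_sym r_sym.
by exists x, y.
Qed.

Lemma kfold_graph_of (A : graph_class) k (r : 'I_k -> rel U) : 0 < k ->
    (forall i, symmetric (r i)) -> (forall i, A U (graph_of (r i))) ->
  kfold_intersection k A (graph_of (fun x y => [forall i, r i x y])).
Proof.
move=> k_gt0 r_sym rA; exists (fun i => graph_of (r i)); split=> // [x|e].
  by apply/idP/forallP => // /(_ (Ordinal k_gt0)).
apply/edges_graph_of/forallP => [[x [y [xV yV xy /forallP rxy ->]]] i|eE].
  by apply/edges_graph_of; exists x, y.
(* One factor, available since [0 < k], names the ends of [e]. The other factors may list them in
   the opposite order, which symmetry makes harmless. *)
have /edges_graph_of[x [y [xV yV xy _ e_xy]]] := eE (Ordinal k_gt0).
exists x, y; split=> //; apply/forallP => i.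
have := eE i; rewrite e_xy -/(adj (graph_of (r i)) x y) adj_graph_of //.
by case/and4P.
Qed.

(** The parts are the fibres of [g]. A vertex adjacent to neither end of an edge would lie in the
    part of both ends, but these parts differ. *)
Lemma multipartite_no_K2_K1 (T : eqType) (g : U -> T) :
  ~ has_K2_K1 (graph_of (fun x y => g x != g y)).
Proof.
have r_sym : symmetric (fun x y => g x != g y) by move=> x y; rewrite eq_sym.
move=> [x [y [z [/= zV /andP[xz yz]]]]]; rewrite !adj_graph_of //.
case/and4P=> xV yV _ xy; rewrite xV yV zV xz yz /= !negbK.
by case/andP=> /eqP xz' /eqP yz'; rewrite xz' yz' eqxx in xy.
Qed.

End GraphOf.

(** * Line graphs *)

Section LineGraph.
Variable T : choiceType.

Definition share_end : rel (T * T) := fun p q =>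
  [|| p.1 == q.1, p.1 == q.2, p.2 == q.1 | p.2 == q.2].

Lemma share_end_sym : symmetric share_end.
Proof.
move=> p q; rewrite /share_end ![q.1 == _]eq_sym ![q.2 == _]eq_sym.
by congr (_ || _); rewrite orbCA.
Qed.

(* By pigeonhole, two of three arcs meeting [c] contain the same end of [c]. *)
Lemma line_graph_no_claw (V : {fset T * T}) :
  ~ has_claw (graph_of V share_end).
Proof.
move=> [c [x [y [z []]]]]; rewrite !adj_graph_of; try exact: share_end_sym.
case/and3P=> xy xz yz /and3P[/and4P[_ xV _ cx] /and4P[_ yV _ cy]].
case/and4P=> _ zV _ cz; rewrite xV yV zV xy xz yz /=.
move: cx cy cz; rewrite /share_end.
case/or4P=> /eqP<-; case/or4P=> /eqP<-; case/or4P=> /eqP<-.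
all: by rewrite !eqxx ?orbT ?andbF.
Qed.

End LineGraph.

(** * The shift graph *)

Section ShiftGraph.
Variable n : nat.
Local Notation arc := ('I_n * 'I_n)%type.

Definition arcs : {fset arc} := [fset p in [pred p : arc | p.1 < p.2]].

Lemma mem_arcs p : (p \in arcs) = (p.1 < p.2).
Proof. by rewrite in_fset. Qed.

Definition shift_factor (i : 'I_3) : rel arc :=
  match val i with
  | 0 => @share_end 'I_n
  | 1 => fun p q => p.1 != q.1
  | _ => fun p q => p.2 != q.2
  end.

Definition shift_graph : graph arc :=
  graph_of arcs (fun p q => [forall i, shift_factor i p q]).

Lemma shift_factor_sym i : symmetric (shift_factor i).
Proof.
case: i => [[|[|i]] lti] p q; rewrite /shift_factor /=.
- exact: share_end_sym.
- by rewrite eq_sym.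
- by rewrite eq_sym.
Qed.

(** Once equal tails and equal heads are excluded, a shared end must be the head of one arc and the
    tail of the other. Conversely, [p.2 = q.1] gives [p.1 < p.2 = q.1 < q.2], so tails and heads
    differ. *)
Lemma adj_shift_graph p q : adj shift_graph p q =
  [&& p.1 < p.2, q.1 < q.2 & (p.2 == q.1) || (q.2 == p.1)].
Proof.
rewrite adj_graph_of; last first.
  by move=> x y; apply: eq_forallb => i; apply: shift_factor_sym.
rewrite !mem_arcs; case: p q => [a b] [c d] /=.
case: (ltnP a b) => //= ab; case: (ltnP c d) => //= cd.
apply/andP/idP => [[_ /forallP arcP]|].
  have arcP_ k (k3 : k < 3) := arcP (Ordinal k3).
  move: (arcP_ 0 isT) (arcP_ 1 isT) (arcP_ 2 isT).
  rewrite /shift_factor /share_end /= [d == a]eq_sym.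
  by move=> /or4P[] // -> //; rewrite ?orbT.
move=> abcd; split.
  by apply/eqP => -[ac bd]; move: abcd ab cd; rewrite -!val_eqE /= ac bd; lia.
apply/forallP => -[[|[|i]] lti]; rewrite /shift_factor /share_end /=;
  rewrite -!val_eqE /= in abcd *; lia.
Qed.

(** Of two adjacent arcs, the one with the smaller tail has its head at the tail of the other. In a
    triangle, the arc with the smallest tail would have its head at two distinct tails. *)
Lemma omega_shift_graph : omega shift_graph <= 2.
Proof.
apply/bigmax_leqP_seq => K _ /forallP Kclique; rewrite leqNgt; apply/negP.
have {Kclique} KP x y : x \in K -> y \in K -> x != y -> adj shift_graph x y.
  move=> xK yK xy.
  by have /forallP/(_ [` yK])/implyP := Kclique [` xK]; apply.
have := fset_uniq K; have inK x : x \in enum_fset K -> x \in K by [].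
case: (enum_fset K) inK => [|x [|y [|z s]]] //= inK.
rewrite !inE !negb_or => /andP[/and3P[xy xz _] /andP[/andP[yz _] _]] _.
have xK : x \in K by apply: inK; rewrite !inE eqxx.
have yK : y \in K by apply: inK; rewrite !inE eqxx orbT.
have zK : z \in K by apply: inK; rewrite !inE eqxx !orbT.
move: (KP x y xK yK xy) (KP x z xK zK xz) (KP y z yK zK yz).
rewrite !adj_shift_graph -!val_eqE /=.
by move=> /and3P[? ? ?] /and3P[? ? ?] /and3P[? ? ?]; lia.
Qed.

(* The sets of colours used on the arcs leaving [i], for [i < n], are pairwise
   distinct: the colour of [(i, j)] occurs on no arc leaving [j]. *)
Lemma shift_graph_colorable c : colorable shift_graph c -> n <= 2 ^ c.
Proof.
case/existsP=> col /forallP colP.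
pose out (i : 'I_n) := [set k | [exists p, (col p == k) && ((val p).1 == i)]].
have out_neq (i j : 'I_n) : i < j -> out i != out j.
  move=> ij; have ijV : (i, j) \in vertices shift_graph by rewrite mem_arcs.
  apply/eqP => /setP/(_ (col [` ijV])); rewrite !inE.
  have -> : [exists p, (col p == col [` ijV]) && ((val p).1 == i)].
    by apply/existsP; exists [` ijV]; rewrite /= !eqxx.
  move/esym/existsP => [p /andP[/eqP col_eq /eqP pj]].
  have /forallP/(_ p)/implyP := colP [` ijV]; rewrite col_eq eqxx.
  rewrite adj_shift_graph /= ij pj eqxx /= andbT => /(_ _)/negP[] //.
  by have := valP p; rewrite mem_arcs pj.
have out_inj : injective out.
  move=> i j out_eq; apply: val_inj; case: (ltngtP i j) => // /out_neq.
    by rewrite out_eq eqxx.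
  by rewrite out_eq eqxx.
(* The [n] sets of colours are distinct subsets of a set of size [c]. *)
have := leq_card _ out_inj; rewrite card_ord -cardsT -powersetT card_powerset.
by rewrite cardsT card_ord.
Qed.

Lemma chi_shift_graph : n <= 2 ^ chi shift_graph.
Proof. by apply: shift_graph_colorable; rewrite /chi; case: ex_minnP. Qed.

Lemma shift_graph_kfold (W : choiceType) (H : graph W) :
  has_claw H -> has_K2_K1 H -> kfold_intersection 3 (free H) shift_graph.
Proof.
move=> clawH K2K1H; apply: kfold_graph_of => // [|i].
  exact: shift_factor_sym.
case: i => [[|[|i]] lti]; rewrite /shift_factor /=.
- exact: free_of_no_claw clawH (@line_graph_no_claw _ _).
- exact: free_of_no_K2_K1 K2K1H (@multipartite_no_K2_K1 _ _ _ fst).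
- exact: free_of_no_K2_K1 K2K1H (@multipartite_no_K2_K1 _ _ _ snd).
Qed.

End ShiftGraph.

Lemma not_self_chi_guarding_free (W : choiceType) (H : graph W) :
  has_claw H -> has_K2_K1 H -> ~ self_chi_guarding (free H).
Proof.
move=> clawH K2K1H /(_ 3 isT)[f f_homo fP].
(* With [n = 2 ^ f 2 + 1], the bound [n <= 2 ^ chi] forces [chi > f 2], while the clique number is
   at most 2 and [f] is monotone. *)
have := fP _ _ (shift_graph_kfold (2 ^ f 2).+1 clawH K2K1H).
rewrite leqNgt => /negP[].
apply: leq_ltn_trans (f_homo _ _ (omega_shift_graph _)) _.
by rewrite -(ltn_exp2l _ _ (ltnSn 1)); apply: chi_shift_graph.
Qed.

Theorem theorem6p3 :
  ~ self_chi_guarding (free chair) /\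
  ~ self_chi_guarding (free (disjoint_union claw K1)).
Proof.
split; apply: not_self_chi_guarding_free.
- exact: chair_has_claw.
- exact: chair_has_K2_K1.
- exact: has_claw_disjoint_union claw_has_claw.
- apply: (@has_K2_K1_disjoint_union _ _ _ _ 0 1 0); last by rewrite inE.
  by rewrite /adj /= !inE fset2_eq.
Qed.
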